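(* Let $G=(V,E)$ be a directed graph, $\mathcal{C}^{=}$ a partition of $E$ such that every part $C\in\mathcal{C}^{=}$ satisfies $C\subseteq\delta^+(v)$ for some vertex $v$, and let $ts\in E$ be an arc from $t$ to $s$. Then there exists $x\in\mathbb{R}^E_{\ge0}$ with $x(\delta^+(v))=x(\delta^-(v))$ for all $v\in V$, $x_e=x_{e'}$ whenever $e,e'$ lie in a common part of $\mathcal{C}^{=}$, and $x_{ts}>0$, if and only if there is no set $X\subseteq V\setminus\{t\}$ with a partition $X=X_0\uplus X_1\uplus\cdots\uplus X_k$ such that $s\in X_0$ and, for every $i\in\{0,\dots,k\}$ and every arc $e\in\delta^+(X_i)$, there is an arc $e'$ coupled to $e$ (possibly $e'=e$) with $e'\in E[X_i,X_j]$ for some $j>i$.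
   Context: For a vertex set $Y$, $\delta^+(Y)$ is the set of arcs with tail in $Y$ and head outside $Y$; $\delta^+(v),\delta^-(v)$ are the outgoing/incoming arcs of $v$; $x(A)=\sum_{e\in A}x_e$; $E[Y,Z]$ is the set of arcs with tail in $Y$ and head in $Z$. Two arcs are coupled if they belong to the same part of $\mathcal{C}^{=}$ (an arc is coupled to itself).
   Formalization: The arc ts is additionally assumed to be coupled only to itself ({ts} is a part of C^=); without this the equivalence fails, e.g. for V={t,s,u}, arcs ts, tu, st and parts {ts,tu}, {st}, where neither x nor X exists. *)

(* Defs.v *)
From HB Require Import structures.
From mathcomp Require Import all_boot all_order all_algebra.
From mathcomp Require Import reals.

Set Implicit Arguments.
Unset Strict Implicit.
Unset Printing Implicit Defensive.

(* A directed graph is given by a finite type of vertices V, a finite type of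
   arcs E and the maps tail, head : E -> V; parallel arcs and loops are
   allowed. *)
Section Digraph.
Variables (V E : finType) (tail head : E -> V).

Definition out_arcs (v : V) : {set E} := [set e | tail e == v].

Definition in_arcs (v : V) : {set E} := [set e | head e == v].

Definition delta_out (Y : {set V}) : {set E} :=
  [set e | (tail e \in Y) && (head e \notin Y)].

Definition arcs_between (Y Z : {set V}) : {set E} :=
  [set e | (tail e \in Y) && (head e \in Z)].

End Digraph.

Definition coupled (E : finType) (C : {set {set E}}) (e e' : E) : bool :=
  [exists A in C, (e \in A) && (e' \in A)].

(* X is partitioned into the nonempty, pairwise disjoint sets
   P_ 0, ..., P_ k, listed without repetition. *)
Definition ordered_partition (V : finType) (k : nat)
    (P_ : 'I_k.+1 -> {set V}) (X : {set V}) : Prop :=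
  injective P_ /\ partition [set P_ i | i : 'I_k.+1] X.

(* Main.v *)
(* By Farkas' lemma, x fails to exist iff some potential y on the vertices has
   y(t) < y(s) and, for every part A with tail v, y(v) is at most the average of
   y over the heads of A. Given such a y, the level sets of y at values at least
   y(s), in increasing order, are the required X_0, ..., X_k: a part with an arc
   leaving a level set has an arc going up. Conversely, a rapidly growing
   function of the index of X_i, extended by 0 outside X, is such a
   potential. *)

Require Import Defs.
From HB Require Import structures.
From mathcomp Require Import all_boot all_order all_algebra.
From mathcomp Require Import boolp reals ring lra.
Import Order.TTheory GRing.Theory Num.Theory.
Local Open Scope ring_scope.

Set Implicit Arguments.
Unset Strict Implicit.
Unset Printing Implicit Defensive.

(* Eliminating [a j] at a point [w0] with [a j w0 < 0]: the functionals
   [a i - (a i w0 / a j w0) a j] are the [a i] composed with the projection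
   along [w0] onto the kernel of [a j]. *)
Lemma farkas (R : realFieldType) (W : lmodType R) (I : eqType) (r : seq I)
    (a : I -> W -> R) (b : W -> R) :
  uniq r -> (forall i, scalar (a i)) -> scalar b ->
  (exists2 l : I -> R, forall i, 0 <= l i
     & forall w, b w = \sum_(i <- r) l i * a i w)
  \/ (exists2 w : W, forall i, i \in r -> 0 <= a i w & b w < 0).
Proof.
elim: r a b => [|j r IHr] a b.
  (* Without functionals, [b] either takes a negative value or, being nonnegative at both [w] and
     [- w], vanishes identically. *)
  move=> _ _ lin_b; have [[w bw]|b_ge0] := EM (exists w, b w < 0).
    by right; exists w.
  left; exists (fun=> 0) => // w; rewrite big_nil.
  have b_ge w' : 0 <= b w'.
    by rewrite leNgt; apply/negP => bw; apply: b_ge0; exists w'.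
  have b0 : b 0 = 0 by have := lin_b 1 0 0; rewrite scaler0 addr0; lra.
  have bN : b (- w) = - b w.
    by have := lin_b (-1) w 0; rewrite scaleN1r addr0 b0; lra.
  by have := b_ge w; have := b_ge (- w); rewrite bN; lra.
rewrite cons_uniq => /andP[jNr r_uniq] lin_a lin_b.
have [[l l_ge0 bE]|[w0 aw0 bw0]] := IHr a b r_uniq lin_a lin_b.
  left; exists (fun i => if i == j then 0 else l i) => [i|w]; first by case: ifP.
  rewrite big_cons eqxx mul0r add0r bE; apply: eq_big_seq => i ir.
  by rewrite (negPf (memPn jNr i ir)).
(* The point [w0] settles the tail of the list; it fails only if [a j] is negative there, and then
   [a j] is eliminated. *)
have [ajw0|ajw0] := leP 0 (a j w0).
  by right; exists w0 => // i; rewrite in_cons => /predU1P[->|/aw0].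
pose proj f w : R := f w - f w0 / a j w0 * a j w.
have lin_proj f : scalar f -> scalar (proj f).
  by move=> lf k u v; rewrite /proj lf lin_a; ring.
have projE f w : scalar f -> f (w - (a j w / a j w0) *: w0) = proj f w.
  by move=> lf; rewrite addrC -scaleNr lf /proj; ring.
have [[l l_ge0 bE]|[w aw bw]] := IHr (fun i => proj (a i)) (proj b) r_uniq
    (fun i => lin_proj _ (lin_a i)) (lin_proj _ lin_b).
  (* Expanding the projections leaves [lj] as the coefficient of [a j]; its numerator and its
     denominator are both negative. *)
  pose lj := (b w0 - \sum_(i <- r) l i * a i w0) / a j w0.
  left; exists (fun i => if i == j then lj else l i) => [i|w].
    case: ifP => // _; rewrite /lj ler_ndivlMr // mul0r subr_le0.
    apply: le_trans (ltW bw0) _; rewrite big_seq sumr_ge0 // => i1 ir.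
    by rewrite mulr_ge0 // aw0.
  rewrite big_cons eqxx.
  rewrite (eq_big_seq (fun i => l i * a i w)) => [|i ir]; last first.
    by rewrite (negPf (memPn jNr i ir)).
  have sumE : \sum_(i <- r) l i * proj (a i) w = \sum_(i <- r) l i * a i w
      - (\sum_(i <- r) l i * a i w0) / a j w0 * a j w.
    by rewrite !mulr_suml -sumrB; apply: eq_bigr => i _; rewrite /proj; ring.
  by have := bE w; rewrite sumE /proj /lj => /eqP; rewrite subr_eq => /eqP ->; ring.
right; exists (w - (a j w / a j w0) *: w0) => [i|]; last by rewrite projE.
rewrite projE // in_cons => /predU1P[->|/aw //].
by rewrite /proj divff ?mul1r ?subrr ?lt_eqF.
Qed.

(** * Circulations and vertex potentials *)

Lemma sum_potential (R : pzRingType) (V E : finType) (f : E -> V) (x : E -> R)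
    (y : V -> R) :
  \sum_e x e * y (f e) = \sum_v (\sum_(e | f e == v) x e) * y v.
Proof.
rewrite (partition_big f predT) //=; apply: eq_bigr => v _.
by rewrite mulr_suml; apply: eq_bigr => e /eqP ->.
Qed.

Section CoupledFlow.
Variables (R : realFieldType) (V E : finType) (tail head : E -> V).

Definition conserved (x : E -> R) :=
  forall v : V, \sum_(e in out_arcs tail v) x e = \sum_(e in in_arcs head v) x e.

Definition rise (y : V -> R) (e : E) : R := y (head e) - y (tail e).

(** Summation by parts turns the sum into the net inflows weighted by [y]; the indicator of a vertex
    isolates conservation there. *)
Lemma conservedP (x : E -> R) :
  conserved x <-> forall y : V -> R, \sum_e x e * rise y e = 0.
Proof.
have sumE y : \sum_e x e * rise y e = \sum_v (\sum_(e in in_arcs head v) x e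
    - \sum_(e in out_arcs tail v) x e) * y v.
  under eq_bigr do rewrite mulrBr.
  rewrite sumrB (sum_potential head) (sum_potential tail) -sumrB.
  apply: eq_bigr => v _.
  rewrite mulrBl; congr (_ * _ - _ * _); apply: eq_bigl => e; by rewrite inE.
split=> [x_cons y|x_orth v].
  by rewrite sumE big1 // => v _; rewrite x_cons subrr mul0r.
have := x_orth (fun u => (u == v)%:R); rewrite sumE (bigD1 v) //= eqxx mulr1.
rewrite [X in _ + X]big1 ?addr0 => [/subr0_eq -> //|u /negPf ->].
by rewrite mulr0.
Qed.

(** * Duality for coupled arcs *)

Variable C : {set {set E}}.
Hypothesis C_partition : partition C [set: E].

Let C_triv : trivIset C. Proof. by case/and3P: C_partition. Qed.

Let C_cover e : e \in cover C.
Proof. by case/and3P: C_partition => /eqP -> _ _; rewrite inE. Qed.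

Lemma sum_parts (F : E -> R) : \sum_e F e = \sum_(A in C) \sum_(e in A) F e.
Proof.
by rewrite -big_trivIset //; apply: eq_bigl => e; rewrite C_cover.
Qed.

Lemma coupled_pblock e e' : coupled C e e' -> pblock C e = pblock C e'.
Proof.
case/exists_inP => A AC /andP[eA e'A].
by rewrite !(def_pblock C_triv AC).
Qed.

Lemma coupled_part (A : {set E}) e e' :
  A \in C -> e \in A -> coupled C e e' = (e' \in A).
Proof.
move=> AC eA; apply/idP/idP => [/coupled_pblock|e'A].
  by rewrite (def_pblock C_triv AC eA) => ->; rewrite mem_pblock.
by apply/exists_inP; exists A => //; rewrite eA.
Qed.

(** By conservation the total of [x e * rise y e] is zero. As [x] is constant on parts, all the
    other parts contribute nonnegative amounts, so [e] cannot contribute a positive one. *)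
Lemma coupled_flow_weak_duality (x : E -> R) (y : V -> R) :
  (forall e, 0 <= x e) -> conserved x ->
  (forall e e', coupled C e e' -> x e = x e') ->
  (forall A, A \in C -> 0 <= \sum_(e in A) rise y e) ->
  forall e, [set e] \in C -> x e * rise y e <= 0.
Proof.
move=> x_ge0 /conservedP x_orth x_coupled y_ge0 e eC.
rewrite -(x_orth y) sum_parts (bigD1 [set e]) //= big_set1 lerDl.
apply: sumr_ge0 => A /andP[AC _].
have [->|[e0 e0A]] := set_0Vmem A; first by rewrite big_set0.
rewrite (eq_bigr (fun e' => x e0 * rise y e')) => [|e' e'A].
  by rewrite -mulr_sumr mulr_ge0 ?y_ge0.
by rewrite (x_coupled e0 e') // (coupled_part _ AC e0A).
Qed.

(** Farkas' lemma on the space of potentials, with the total rise of each part as a functional,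
    against minus the rise of [ts]. *)
Lemma coupled_flow_alternative (ts : E) :
  [set ts] \in C ->
  (exists x : E -> R,
     [/\ forall e, 0 <= x e, conserved x,
         forall e e', coupled C e e' -> x e = x e' & 0 < x ts])
  \/ (exists2 y : V -> R, forall A, A \in C -> 0 <= \sum_(e in A) rise y e
        & 0 < rise y ts).
Proof.
move=> tsC; pose W : lmodType R := {ffun V -> R^o}.
pose a (A : {set E}) (y : W) := \sum_(e in A) rise y e.
have lin_a A : scalar (a A).
  move=> k u v; rewrite /a mulr_sumr -big_split; apply: eq_bigr => e _ /=.
  by rewrite /rise !ffunE /GRing.scale /=; ring.
have lin_b : scalar (fun y => - a [set ts] y).
  by move=> k u v; rewrite lin_a; ring.
have [[l l_ge0 lE]|[y y_ge0 y_lt0]] := farkas (enum_uniq C) lin_a lin_b; last first.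
  right; exists y => [A AC|]; first by apply: y_ge0; rewrite mem_enum.
  by move: y_lt0; rewrite oppr_lt0 /a big_set1.
(* The multipliers represent minus the rise of [ts], so one extra unit on [ts] balances them and
   makes the flow positive there. *)
left; exists (fun e => l (pblock C e) + (e == ts)%:R); split.
- by move=> e; rewrite addr_ge0.
- apply/conservedP => y; under eq_bigr do rewrite mulrDl.
  rewrite big_split /= sum_parts; have := lE [ffun v => y v].
  rewrite big_enum /= /a big_set1 {1}/rise !ffunE => lEy.
  rewrite (bigD1 ts) //= [in X in _ + X]big1 => [|e /negPf ->]; last first.
    by rewrite mul0r.
  rewrite eqxx mul1r addr0 {2}/rise; apply/eqP; rewrite addr_eq0 lEy; apply/eqP.
  apply: eq_bigr => A AC; rewrite mulr_sumr; apply: eq_bigr => e eA.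
  by rewrite (def_pblock C_triv AC eA) /rise !ffunE.
- move=> e e' ee'; rewrite (coupled_pblock ee'); congr (_ + _%:R).
  have sets1 u : (u == ts) = (u \in pblock C ts).
    by rewrite (def_pblock C_triv tsC) ?inE.
  by rewrite !sets1 -!eq_pblock // eq_sym (coupled_pblock ee') eq_sym.
- by rewrite eqxx ltr_wpDl.
Qed.

(** * Ordered partitions and potentials *)

Hypothesis C_out : forall A : {set E}, A \in C ->
  exists v : V, A \subset out_arcs tail v.

Lemma part_tail (A : {set E}) e e' :
  A \in C -> e \in A -> e' \in A -> tail e' = tail e.
Proof.
move=> /C_out[v /subsetP Av] /Av; rewrite inE => /eqP -> /Av.
by rewrite inE => /eqP.
Qed.

Definition ascending k (P_ : 'I_k.+1 -> {set V}) :=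
  forall (i : 'I_k.+1) (e : E), e \in delta_out tail head (P_ i) ->
    exists2 e' : E, coupled C e e' &
      exists2 j : 'I_k.+1, (i < j)%N &
        e' \in arcs_between tail head (P_ i) (P_ j).

(* [#|E|.+1 ^+ i] on the [i]-th block and 0 outside: one arc to a higher block
   outweighs all the other arcs of its part. *)
Lemma ascending_potential k (P_ : 'I_k.+1 -> {set V}) (X : {set V}) :
  ordered_partition P_ X -> ascending P_ ->
  exists y : V -> R,
    [/\ forall A, A \in C -> 0 <= \sum_(e in A) rise y e,
        forall v, v \notin X -> y v = 0 &
        forall v i, v \in P_ i -> y v = #|E|.+1%:R ^+ i].
Proof.
move=> [P_inj /and3P[/eqP coverP trivP _]] P_asc.
have PX v i : v \in P_ i -> v \in X.
  move=> vi; rewrite -coverP; apply/bigcupP; exists (P_ i) => //.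
  exact: imset_f.
have P_uniq v i j : v \in P_ i -> v \in P_ j -> i = j.
  move=> vi vj; apply: P_inj.
  rewrite -(def_pblock trivP (imset_f _ _) vi) //.
  by rewrite (def_pblock trivP (imset_f _ _) vj).
pose N : R := #|E|.+1%:R.
have N_ge1 : 1 <= N by rewrite ler1n.
have N_ge0 : 0 <= N by rewrite ler0n.
(* Disjointness leaves at most one term; the empty sum supplies the value 0 outside [X]. *)
pose y v := \sum_(i | v \in P_ i) N ^+ i.
have y_ge0 v : 0 <= y v by apply: sumr_ge0 => i _; apply: exprn_ge0.
have yP v i : v \in P_ i -> y v = N ^+ i.
  move=> vi; rewrite /y (big_pred1 i) // => j; apply/idP/eqP => [vj|-> //].
  exact: P_uniq vj vi.
have y0 v : v \notin X -> y v = 0.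
  by move=> vX; rewrite /y big1 // => i /PX vX'; rewrite vX' in vX.
exists y; split=> // A AC; rewrite /rise sumrB subr_ge0.
have [->|[e eA]] := set_0Vmem A; first by rewrite !big_set0.
rewrite [leLHS](eq_bigr (fun=> y (tail e))) => [|e' e'A]; last first.
  by rewrite (part_tail AC eA e'A).
rewrite sumr_const.
have [|tX] := boolP (tail e \in X); last first.
  by rewrite y0 // mul0rn sumr_ge0.
rewrite -coverP => /bigcupP[_ /imsetP[i _ ->] ti].
have [/forall_inP stay|/forall_inPn[e' e'A leave]] :=
  boolP [forall e' in A, head e' \in P_ i].
  rewrite (yP _ i ti) (eq_bigr (fun=> N ^+ i)) ?sumr_const // => e' /stay.
  exact: yP.
have [|e'' e'e'' [j ij]] := P_asc i e'.
  by rewrite inE leave (part_tail AC eA e'A) ti.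
rewrite inE => /andP[_ hj].
have e''A : e'' \in A by rewrite -(coupled_part _ AC e'A).
rewrite (bigD1 e'') //= (yP _ i ti) (yP _ j hj) -[leLHS]addr0.
apply: lerD; last exact: sumr_ge0.
(* Since [#|A| <= N], the [#|A|] copies of [N ^+ i] sum to at most [N ^+ i.+1]. *)
apply: le_trans (ler_weXn2l N_ge1 ij); rewrite exprS -mulr_natl.
apply: ler_wpM2r; first exact: exprn_ge0.
by rewrite ler_nat (leq_trans (max_card _)).
Qed.

(** If no arc of the part rose, the nonzero rise of [e] would be negative and drag the sum below
    zero. *)
Lemma part_rise (y : V -> R) (A : {set E}) e :
  A \in C -> e \in A -> 0 <= \sum_(e' in A) rise y e' -> rise y e != 0 ->
  exists2 e', e' \in A & 0 < rise y e'.
Proof.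
move=> AC eA A_ge0 e_neq0; apply/exists_inP; apply: contraTT A_ge0.
rewrite negb_exists_in => /forall_inP le0; rewrite -ltNge (bigD1 e) //=.
have le0' e' : e' \in A -> rise y e' <= 0 by move/le0; rewrite -leNgt.
rewrite -[ltRHS]addr0 ltr_leD //; first by rewrite lt_neqAle e_neq0 le0'.
by apply: sumr_le0 => e' /andP[e'A _]; apply: le0'.
Qed.

Lemma potential_ascending (y : V -> R) (s : V) :
  (forall A, A \in C -> 0 <= \sum_(e in A) rise y e) ->
  exists k (P_ : 'I_k.+1 -> {set V}),
    [/\ ordered_partition P_ [set v | y s <= y v], s \in P_ ord0
      & ascending P_].
Proof.
move=> y_ge0; set X := [set v | y s <= y v].
(* The values of [y] on [X], increasing and without repetition: the position of a value is the index
   of its level set. *)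
pose r := sort <=%R (undup [seq y v | v in X]).
have mem_r c : (c \in r) = (c \in [seq y v | v in X]) by rewrite mem_sort mem_undup.
have yr v : y s <= y v -> y v \in r.
  by move=> sv; rewrite mem_r; apply/imageP; exists v; rewrite ?inE.
have r_lt : sorted <%R r by rewrite sort_lt_sorted undup_uniq.
have r_uniq : uniq r by rewrite sort_uniq undup_uniq.
have szr : (size r).-1.+1 = size r.
  by rewrite prednK //; move: (yr s (lexx _)); case: (r).
pose P_ (i : 'I_(size r).-1.+1) := [set v | y v == r`_i].
have ir (i : 'I_(size r).-1.+1) : (i < size r)%N by rewrite -[ltnRHS]szr.
have PX i v : v \in P_ i -> y s <= y v.
  rewrite inE => /eqP ->; have := mem_nth 0 (ir i).
  by rewrite mem_r => /imageP[u]; rewrite inE => su ->.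
have XP v : y s <= y v -> exists i, v \in P_ i.
  move=> /yr yvr; have lt_i : (index (y v) r < (size r).-1.+1)%N.
    by rewrite szr index_mem.
  by exists (Ordinal lt_i); rewrite inE /= nth_index.
have P_neq0 i : exists v, v \in P_ i.
  have := mem_nth 0 (ir i).
  by rewrite mem_r => /imageP[v _ vi]; exists v; rewrite inE vi.
have P_uniq v i j : v \in P_ i -> v \in P_ j -> i = j.
  rewrite !inE => /eqP -> /eqP eq_ij; apply/val_inj/eqP.
  by rewrite -(nth_uniq 0 (ir i) (ir j) r_uniq) eq_ij.
exists (size r).-1, P_; split.
- split=> [i j Pij|].
    by have [v vi] := P_neq0 i; apply: P_uniq (vi) _; rewrite -Pij.
  apply/and3P; split.
  + apply/eqP/setP => v; rewrite inE; apply/bigcupP/idP => [[_ /imsetP[i _ ->]]|].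
      exact: PX.
    by case/XP => i vi; exists (P_ i); rewrite ?imset_f.
  + apply/trivIsetP => _ _ /imsetP[i _ ->] /imsetP[j _ ->] Pij.
    apply/pred0P => v /=; apply/negP => /andP[vi vj].
    by rewrite (P_uniq v i j vi vj) eqxx in Pij.
  + by apply/imsetP => -[i _ Pi]; have [v] := P_neq0 i; rewrite -Pi inE.
(* The value at [s] is least on [X]: a positive index would put the first entry of [r] strictly
   below [y s]. *)
- have [i si] := XP s (lexx _); have [v v0] := P_neq0 ord0.
  suff -> : ord0 = i by [].
  apply/val_inj/eqP; rewrite eq_sym -leqn0 leqNgt /=; apply/negP => i_gt0.
  have := PX ord0 v v0; move: si v0; rewrite !inE => /eqP -> /eqP ->.
  by rewrite leNgt (lt_sorted_ltn_nth 0 r_lt) ?inE ?i_gt0.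
move=> i e; rewrite inE => /andP[ti hi].
have eA : e \in pblock C e by rewrite mem_pblock.
have AC : pblock C e \in C by rewrite pblock_mem.
have [|e' e'A e'_gt0] := part_rise AC eA (y_ge0 _ AC).
  rewrite subr_eq0; apply: contraNneq hi => hteq.
  by move: ti; rewrite !inE hteq.
have te' := part_tail AC eA e'A.
have lt_e' : y (tail e) < y (head e') by rewrite -te' -subr_gt0.
exists e'; first by rewrite (coupled_part _ AC eA).
(* The head of a rising arc stays in [X], which is closed upward for [y]. *)
have [j hj] := XP (head e') (le_trans (PX _ _ ti) (ltW lt_e')).
exists j; last by rewrite inE te' ti.
rewrite -(lt_sorted_ltn_nth 0 r_lt) ?inE //.
by move: ti hj; rewrite !inE => /eqP <- /eqP <-.
Qed.

End CoupledFlow.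

Theorem theorem5 (R : realType) (V E : finType) (tail head : E -> V)
    (C : {set {set E}}) (t s : V) (ts : E)
    (C_partition : partition C [set: E])
    (C_out : forall A : {set E}, A \in C ->
       exists v : V, A \subset out_arcs tail v)
    (tail_ts : tail ts = t) (head_ts : head ts = s)
    (* ts is coupled only to itself; otherwise the equivalence fails, e.g. for
       the arcs ts, tu, st with parts {ts, tu} and {st}. *)
    (ts_uncoupled : [set ts] \in C) :
  (exists x : E -> R,
     [/\ forall e : E, 0 <= x e,
         forall v : V, \sum_(e in out_arcs tail v) x e
                     = \sum_(e in in_arcs head v) x e,
         forall e e' : E, coupled C e e' -> x e = x e'
       & 0 < x ts])
  <->
  ~ (exists (X : {set V}) (k : nat) (P_ : 'I_k.+1 -> {set V}),
       [/\ X \subset [set~ t],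
           ordered_partition P_ X,
           s \in P_ ord0
         & forall (i : 'I_k.+1) (e : E), e \in delta_out tail head (P_ i) ->
             exists2 e' : E, coupled C e e' &
               exists2 j : 'I_k.+1, (i < j)%N &
                 e' \in arcs_between tail head (P_ i) (P_ j)]).
Proof.
split=> [[x [x_ge0 x_cons x_coupled x_gt0]] [X [k [P_ [Xt P_part s0 P_asc]]]]|no_X].
  (* This potential is 1 at [s] and 0 at [t], so [ts] has rise 1 and weak duality contradicts
     [0 < x ts]. *)
  have [y [y_ge0 y0 yP]] := ascending_potential R C_partition C_out P_part P_asc.
  have := coupled_flow_weak_duality C_partition x_ge0 x_cons x_coupled y_ge0
    ts_uncoupled.
  rewrite /rise tail_ts head_ts (yP _ _ s0) y0 ?expr0 ?subr0 ?mulr1 1?leNgt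
    ?x_gt0 //.
  by apply/negP => /(subsetP Xt); rewrite !inE eqxx.
have [//|[y y_ge0 y_gt0]] :=
  coupled_flow_alternative R tail head C_partition ts_uncoupled.
have [k [P_ [P_part s0 P_asc]]] := potential_ascending C_partition C_out s y_ge0.
case: no_X; exists [set v | y s <= y v], k, P_; split=> //.
apply/subsetP => v; rewrite !inE; apply: contraTneq => ->.
by rewrite -ltNge -subr_gt0 -head_ts -tail_ts.
Qed.
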